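(* Let $\Delta t>0$. Assume that the frozen metric forms $\mathcal{G}_\nu^n,\mathcal{G}_\tau^n$ are symmetric and positive definite on the relevant scalar function spaces, and that the frozen stabilization forms $\mathcal{D}_\nu^n,\mathcal{D}_\tau^n$ are symmetric and positive semi-definite. Suppose that $r_{\mathrm g}^{n+1}\neq 0$ and that $V_\nu^{n+1},V_\tau^{n+1},r_{\mathrm g}^{n+1},r_{\mathrm m}^{n+1},\lambda_1^{n+1},\dots,\lambda_K^{n+1}$ satisfy the time-discrete dual-SAV scheme (defined in the context). Then $$\frac{(r_{\mathrm g}^{n+1})^2-(r_{\mathrm g}^n)^2}{\Delta t}\le-\mathcal{G}_\nu^n(V_\nu^{n+1},V_\nu^{n+1})-\Delta t\,\mathcal{D}_\nu^n(V_\nu^{n+1},V_\nu^{n+1})\le 0,$$ $$\frac{(r_{\mathrm m}^{n+1})^2-(r_{\mathrm m}^n)^2}{\Delta t}\le-\mathcal{G}_\tau^n(V_\tau^{n+1},V_\tau^{n+1})-\Delta t\,\mathcal{D}_\tau^n(V_\tau^{n+1},V_\tau^{n+1})\le 0.$$ Consequently, the time-discrete modified geometric and mesh SAV energies $(r_{\mathrm g}^n)^2$ and $(r_{\mathrm m}^n)^2$ are nonincreasing in $n$ for any time step size for which the discrete system is solvable.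
   Context: Setting. $\bm{\gamma}^n$ is a regular closed planar curve (the approximation at time $t^n=n\Delta t$), with unit tangent $\bm{\tau}^n$ and unit normal $\bm{\nu}^n$ such that $(\bm{\tau}^n,\bm{\nu}^n)$ is a positively oriented orthonormal basis. $\mathbb{V}^n=\mathbb{V}(\bm{\gamma}^n)$ is a real scalar function space on $\bm{\gamma}^n$, sufficiently regular that all forms and pairings below are well-defined, and $(u,v)^n=\int_{\bm{\gamma}^n}uv\,\mathrm ds$. (When the normal metric is the $H^{-1}$ metric, the normal velocity is taken in the zero-mean class $\{v\in L^2(\bm{\gamma}^n):\int_{\bm{\gamma}^n}v\,\mathrm ds=0\}$, which is then the relevant space for the normal equation.) Data, all evaluated on the known curve $\bm{\gamma}^n$ and treated as fixed during the step from $t^n$ to $t^{n+1}$ (frozen). - $w_{\mathrm g}^n$ is the scalar normal force of a geometric energy $E_{\mathrm{geom}}$ invariant under tangential reparametrization: $\nabla_{L^2}E_{\mathrm{geom}}=w_{\mathrm g}\bm{\nu}$. - $w_{\mathrm m}^n$ is the scalar tangential force corresponding to the tangential component of the driving force of an artificial mesh energy $E_{\mathrm{mesh}}$. - $g_i^n$, $i=1,\dots,K$, are the scalar constraint gradients: $\nabla_{L^2}C_i=g_i\bm{\nu}$ for geometric constraint functionals $C_i$. - $\mathcal{G}_\nu^n,\mathcal{G}_\tau^n$ (metric) and $\mathcal{D}_\nu^n,\mathcal{D}_\tau^n$ (stabilization) are real bilinear forms on $\mathbb{V}^n\times\mathbb{V}^n$. - $S_{\mathrm g}^n=\sqrt{E_{\mathrm{geom}}(\bm{\gamma}^n)+C_{\mathrm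 g}}$ and $S_{\mathrm m}^n=\sqrt{E_{\mathrm{mesh}}(\bm{\gamma}^n)+C_{\mathrm m}}$, where $C_{\mathrm g},C_{\mathrm m}>0$ are fixed constants such that the radicands are positive. Time-discrete dual-SAV scheme. Given $\bm{\gamma}^n$, $r_{\mathrm g}^n,r_{\mathrm m}^n\in\mathbb{R}$, find $V_\nu^{n+1},V_\tau^{n+1}\in\mathbb{V}^n$, $r_{\mathrm g}^{n+1},r_{\mathrm m}^{n+1}\in\mathbb{R}$ and $\lambda_i^{n+1}\in\mathbb{R}$ ($i=1,\dots,K$) such that for all $\varphi_\nu,\varphi_\tau\in\mathbb{V}^n$: $$\mathcal{G}_\nu^n(V_\nu^{n+1},\varphi_\nu)+\Delta t\,\mathcal{D}_\nu^n(V_\nu^{n+1},\varphi_\nu)=-\frac{r_{\mathrm g}^{n+1}}{S_{\mathrm g}^n}(w_{\mathrm g}^n,\varphi_\nu)^n-\sum_{i=1}^K\lambda_i^{n+1}(g_i^n,\varphi_\nu)^n,$$ $$\frac{r_{\mathrm g}^{n+1}-r_{\mathrm g}^n}{\Delta t}=\frac{1}{2S_{\mathrm g}^n}(w_{\mathrm g}^n,V_\nu^{n+1})^n+\sum_{i=1}^K\frac{\lambda_i^{n+1}}{2r_{\mathrm g}^{n+1}}(g_i^n,V_\nu^{n+1})^n,$$ $$\mathcal{G}_\tau^n(V_\tau^{n+1},\varphi_\tau)+\Delta t\,\mathcal{D}_\tau^n(V_\tau^{n+1},\varphi_\tau)=-\frac{r_{\mathrm m}^{n+1}}{S_{\mathrm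 m}^n}(w_{\mathrm m}^n,\varphi_\tau)^n,$$ $$\frac{r_{\mathrm m}^{n+1}-r_{\mathrm m}^n}{\Delta t}=\frac{1}{2S_{\mathrm m}^n}(w_{\mathrm m}^n,V_\tau^{n+1})^n,$$ $$C_i\big(\bm{\gamma}^n+\Delta t\,(V_\nu^{n+1}\bm{\nu}^n+V_\tau^{n+1}\bm{\tau}^n)\big)=0,\qquad i=1,\dots,K.$$ The curve is updated by $\bm{\gamma}^{n+1}=\bm{\gamma}^n+\Delta t\,(V_\nu^{n+1}\bm{\nu}^n+V_\tau^{n+1}\bm{\tau}^n)$. *)

(* Defs.v *)
From HB Require Import structures.
From mathcomp Require Import all_boot all_order all_algebra.
From mathcomp Require Import all_classical all_reals all_analysis.

Set Implicit Arguments.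
Unset Strict Implicit.
Unset Printing Implicit Defensive.

Import Order.TTheory GRing.Theory Num.Theory.
Import numFieldNormedType.Exports.

Local Open Scope classical_set_scope.
Local Open Scope ring_scope.

(* A closed planar curve is parametrized by R/Z, i.e. it is a 1-periodic map
   R -> R^2.  Scalar functions and vector fields on the curve are 1-periodic
   functions of the same parameter. *)
Definition curve (R : realType) := R -> 'rV[R]_2.

Definition periodic1 (R : realType) (T : Type) (f : R -> T) : Prop :=
  forall p, f (p + 1) = f p.

(* The library norm on 'rV_2 is the sup norm, hence the explicit Euclidean
   structure. *)
Definition dot (R : realType) (u v : 'rV[R]_2) : R := \sum_(i < 2) u 0 i * v 0 i.

Definition enorm2 (R : realType) (u : 'rV[R]_2) : R := Num.sqrt (dot u u).

(* Counterclockwise rotation by a right angle: (x, y) |-> (- y, x). *)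
Definition rot (R : realType) (u : 'rV[R]_2) : 'rV[R]_2 :=
  \row_(j < 2) (if j == 0 then - u 0 1 else u 0 0).

Section Curves.
Variable R : realType.
Implicit Types (c : curve R) (u v w : R -> R) (V : set (R -> R)).

Definition regular_closed c : Prop :=
  [/\ periodic1 c,
      forall p, derivable c p 1,
      continuous (derive1 c)
    & forall p, derive1 c p != 0].

Definition speed c (p : R) : R := enorm2 (derive1 c p).

Definition tangent c (p : R) : 'rV[R]_2 := (speed c p)^-1 *: derive1 c p.

Definition normal c (p : R) : 'rV[R]_2 := rot (tangent c p).

(* With respect to arc length, ds = |c'(p)| dp. *)
Definition curve_integral c u : R :=
  Rintegral (@lebesgue_measure R) `[0, 1] (fun p => u p * speed c p).

Definition curve_integrable c u : Prop :=
  (@lebesgue_measure R).-integrable `[0, 1] (fun p => (u p * speed c p)%:E).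

Definition pairing c u v : R := curve_integral c (fun p => u p * v p).

Definition smooth (W : normedModType R) (f : R -> W) : Prop :=
  forall n p, derivable (derive1n n f) p 1.

(* W is the L^2(ds)-gradient of the functional E at c: the first variation of E
   in every smooth direction X is the integral of W . X. *)
Definition L2_gradient (E : curve R -> R) c (W : R -> 'rV[R]_2) : Prop :=
  periodic1 W /\
  forall X : R -> 'rV[R]_2, periodic1 X -> smooth X ->
    curve_integrable c (fun p => dot (W p) (X p)) /\
    is_derive (0 : R) 1 (fun e : R => E (fun p => c p + e *: X p))
      (curve_integral c (fun p => dot (W p) (X p))).

(* Invariance under orientation-preserving reparametrizations of R/Z, given by
   their lifts to R. *)
Definition reparam_invariant (E : curve R -> R) : Prop :=
  forall c (h : R -> R), regular_closed c ->
    smooth (h : R -> R^o) ->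
    (forall p, 0 < derive1 (h : R -> R^o) p) ->
    (forall p, h (p + 1) = h p + 1) ->
    E (c \o h) = E c.

(* Elements are representatives of functions modulo almost everywhere equality,
   so that L^2-type spaces are covered along with spaces of continuous
   functions.  On a regular curve, null sets for ds and dp agree. *)
Definition function_space V : Prop :=
  [/\ forall v, V v -> periodic1 v /\ measurable_fun setT v,
      V (fun=> 0)
    & forall a u v, V u -> V v -> V (fun p => a * u p + v p)].

Definition curve_ae_eq u v : Prop := ae_eq (@lebesgue_measure R) setT u v.

Section Forms.
Variables (V : set (R -> R)) (B : (R -> R) -> (R -> R) -> R).

(* The last condition says that B is well defined on classes. *)
Definition bilinear_on : Prop :=
  [/\ forall a u v w, V u -> V v -> V w ->
        B (fun p => a * u p + v p) w = a * B u w + B v w,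
      forall a u v w, V u -> V v -> V w ->
        B w (fun p => a * u p + v p) = a * B w u + B w v
    & forall u u' v v', V u -> V u' -> V v -> V v' ->
        curve_ae_eq u u' -> curve_ae_eq v v' -> B u v = B u' v'].

Definition symmetric_on : Prop := forall u v, V u -> V v -> B u v = B v u.

Definition posdef_on : Prop :=
  forall v, V v -> ~ curve_ae_eq v (fun=> 0) -> 0 < B v v.

Definition possemidef_on : Prop := forall v, V v -> 0 <= B v v.

End Forms.

Definition sav_root (E : curve R -> R) (C : R) c : R := Num.sqrt (E c + C).

Definition move_curve c (dt : R) (vnu vtau : R -> R) : curve R :=
  fun p => c p + dt *: (vnu p *: normal c p + vtau p *: tangent c p).

End Curves.

(* Two function spaces are kept, because the normal velocity may live in a
   different class from the tangential one (zero-mean functions for an H^{-1}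
   normal metric). *)
Record frozen (R : realType) (K : nat) := Frozen {
  fcurve : curve R;
  Vnu : set (R -> R);
  Vtau : set (R -> R);
  wg : R -> R;
  wm : R -> R;
  gc : 'I_K -> R -> R;
  Gnu : (R -> R) -> (R -> R) -> R;
  Gtau : (R -> R) -> (R -> R) -> R;
  Dnu : (R -> R) -> (R -> R) -> R;
  Dtau : (R -> R) -> (R -> R) -> R
}.

Record functionals (R : realType) (K : nat) := Functionals {
  Egeom : curve R -> R;
  Emesh : curve R -> R;
  Ccon : 'I_K -> curve R -> R;
  Cg : R;
  Cm : R
}.

Definition admissible_functionals (R : realType) (K : nat)
    (P : functionals R K) : Prop :=
  [/\ reparam_invariant (Egeom P),
      forall i, reparam_invariant (Ccon P i),
      0 < Cg P
    & 0 < Cm P].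

Record frozen_data (R : realType) (K : nat) (P : functionals R K)
    (F : frozen R K) : Prop := FrozenData {
  fd_curve : regular_closed (fcurve F);
  fd_Vnu : function_space (Vnu F);
  fd_Vtau : function_space (Vtau F);
  fd_periodic : [/\ periodic1 (wg F), periodic1 (wm F)
                  & forall i, periodic1 (gc F i)];
  fd_wg : L2_gradient (Egeom P) (fcurve F)
            (fun p => wg F p *: normal (fcurve F) p);
  (* wm is the tangential component of the gradient of the mesh energy, whose
     normal component is arbitrary. *)
  fd_wm : exists2 W, L2_gradient (Emesh P) (fcurve F) W
            & forall p, wm F p = dot (W p) (tangent (fcurve F) p);
  fd_gc : forall i, L2_gradient (Ccon P i) (fcurve F)
            (fun p => gc F i p *: normal (fcurve F) p);
  fd_wg_pair : forall v, Vnu F v ->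
    curve_integrable (fcurve F) (fun p => wg F p * v p);
  fd_wm_pair : forall v, Vtau F v ->
    curve_integrable (fcurve F) (fun p => wm F p * v p);
  fd_gc_pair : forall i v, Vnu F v ->
    curve_integrable (fcurve F) (fun p => gc F i p * v p);
  fd_Gnu : bilinear_on (Vnu F) (Gnu F);
  fd_Gtau : bilinear_on (Vtau F) (Gtau F);
  fd_Dnu : bilinear_on (Vnu F) (Dnu F);
  fd_Dtau : bilinear_on (Vtau F) (Dtau F);
  fd_Sg : 0 < Egeom P (fcurve F) + Cg P;
  fd_Sm : 0 < Emesh P (fcurve F) + Cm P
}.

Definition metrics_posdef (R : realType) (K : nat) (F : frozen R K) : Prop :=
  [/\ symmetric_on (Vnu F) (Gnu F), posdef_on (Vnu F) (Gnu F),
      symmetric_on (Vtau F) (Gtau F) & posdef_on (Vtau F) (Gtau F)].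

Definition stabilizations_possemidef (R : realType) (K : nat)
    (F : frozen R K) : Prop :=
  [/\ symmetric_on (Vnu F) (Dnu F), possemidef_on (Vnu F) (Dnu F),
      symmetric_on (Vtau F) (Dtau F) & possemidef_on (Vtau F) (Dtau F)].

(* Unprimed r's are the values at t^n; rg', rm', vnu, vtau, lam are the unknowns
   at t^{n+1}. *)
Record dual_sav_step (R : realType) (K : nat) (P : functionals R K) (dt : R)
    (F : frozen R K) (rg rm : R) (vnu vtau : R -> R) (rg' rm' : R)
    (lam : 'I_K -> R) : Prop := DualSavStep {
  dss_vnu : Vnu F vnu;
  dss_vtau : Vtau F vtau;
  dss_normal : forall phi, Vnu F phi ->
    Gnu F vnu phi + dt * Dnu F vnu phi
    = - (rg' / sav_root (Egeom P) (Cg P) (fcurve F))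
        * pairing (fcurve F) (wg F) phi
      - \sum_(i < K) lam i * pairing (fcurve F) (gc F i) phi;
  dss_rg : (rg' - rg) / dt
    = (2 * sav_root (Egeom P) (Cg P) (fcurve F))^-1
        * pairing (fcurve F) (wg F) vnu
      + \sum_(i < K) lam i / (2 * rg') * pairing (fcurve F) (gc F i) vnu;
  dss_tangential : forall phi, Vtau F phi ->
    Gtau F vtau phi + dt * Dtau F vtau phi
    = - (rm' / sav_root (Emesh P) (Cm P) (fcurve F))
        * pairing (fcurve F) (wm F) phi;
  dss_rm : (rm' - rm) / dt
    = (2 * sav_root (Emesh P) (Cm P) (fcurve F))^-1
        * pairing (fcurve F) (wm F) vtau;
  dss_constraints : forall i : 'I_K,
    Ccon P i (move_curve (fcurve F) dt vnu vtau) = 0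
}.

(* Main.v *)
(** Testing the velocity equation with the new velocity itself and multiplying
    the auxiliary equation by [2 r'] makes the force and multiplier terms cancel,
    so that [2 r' (r' - r) / dt = - G(V, V) - dt D(V, V)]; the claim follows from
    [2 r' (r' - r) = r'^2 - r^2 + (r' - r)^2]. *)

Require Import Defs.
From HB Require Import structures.
From mathcomp Require Import all_boot all_order all_algebra.
From mathcomp Require Import all_classical all_reals all_analysis.
From mathcomp Require Import ring lra.

Import Order.TTheory GRing.Theory Num.Theory.
Import numFieldNormedType.Exports.

Local Open Scope ring_scope.

Set Implicit Arguments.
Unset Strict Implicit.

Lemma bilinear_on00 (R : realType) (V : set (R -> R))
    (B : (R -> R) -> (R -> R) -> R) :
  function_space V -> bilinear_on V B -> B (fun=> 0) (fun=> 0) = 0.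
Proof.
move=> [_ V0 _] [addl _ _].
have := addl 1 _ _ _ V0 V0 V0.
(* With [a = 1] and all arguments zero, additivity reads [B 0 0 = B 0 0 + B 0 0] once the
   combination is recognized as the zero function. *)
rewrite (_ : (fun p => 1 * 0 + 0) = (fun=> 0)); last first.
  by apply/funext => p; rewrite mulr0 addr0.
by rewrite mul1r => B00; lra.
Qed.

(* Definiteness says nothing on the null class, where well-definedness on
   classes is needed. *)
Lemma posdef_on_ge0 (R : realType) (V : set (R -> R))
    (B : (R -> R) -> (R -> R) -> R) :
  function_space V -> bilinear_on V B -> posdef_on V B -> possemidef_on V B.
Proof.
move=> fV bB pB v Vv.
have [v0|vN0] := pselect (curve_ae_eq v (fun=> 0)); last exact/ltW/pB.
have [_ V0 _] := fV; have [_ _ wd] := bB.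
by rewrite (wd _ _ _ _ Vv V0 Vv V0 v0 v0) (bilinear_on00 fV bB).
Qed.

Lemma implicit_step_dissipation (R : realFieldType) (dt r r' Q : R) :
  0 < dt -> 2 * r' * ((r' - r) / dt) = - Q -> 0 <= Q ->
  (r' ^+ 2 - r ^+ 2) / dt <= - Q <= 0.
Proof.
move=> dt0 eQ Q0; rewrite oppr_le0 Q0 andbT -eQ mulrA ler_pM2r ?invr_gt0 //.
(* With [dt] cleared, the gap between the two sides is exactly the square [(r' - r) ^+ 2]: the
   numerical dissipation of the implicit step, which turns the identity into an inequality. *)
rewrite -subr_ge0 (_ : _ - _ = (r' - r) ^+ 2) ?sqr_ge0 //; ring.
Qed.

Lemma normal_energy_dissipation (R : realType) (K : nat) (P : functionals R K)
    (dt : R) (F : frozen R K) (rg rm : R) (vnu vtau : R -> R) (rg' rm' : R)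
    (lam : 'I_K -> R) :
  0 < dt -> frozen_data P F -> metrics_posdef F ->
  stabilizations_possemidef F ->
  dual_sav_step P dt F rg rm vnu vtau rg' rm' lam ->
  rg' != 0 ->
  (rg' ^+ 2 - rg ^+ 2) / dt <= - Gnu F vnu vnu - dt * Dnu F vnu vnu <= 0.
Proof.
move=> dt_gt0 FP GF DF step rg'0.
have [_ Gpos _ _] := GF; have [_ Dpos _ _] := DF.
have Vv := dss_vnu step; rewrite -opprD.
apply: implicit_step_dissipation => //; last first.
  apply: addr_ge0; last by rewrite mulr_ge0 ?Dpos // ltW.
  exact: (posdef_on_ge0 (fd_Vnu FP) (fd_Gnu FP)).
(* The radicand is positive, so the root can be cancelled by [field] below. *)
have S0 : sav_root (Egeom P) (Cg P) (fcurve F) != 0.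
  by rewrite gt_eqF // sqrtr_gt0 (fd_Sg FP).
(* The test function is [vnu] itself, so both equations contain the same pairings. *)
rewrite (dss_rg step) (dss_normal step) // opprB mulNr opprK.
rewrite mulrDr mulr_sumr addrC.
congr (_ + _); last by field.
(* Each multiplier term cancels separately: the factor [2 * rg'] meets the denominator [2 * rg'],
   which is where [rg'0] enters. *)
by apply: eq_bigr => i _; field.
Qed.

Lemma tangential_energy_dissipation (R : realType) (K : nat) (P : functionals R K)
    (dt : R) (F : frozen R K) (rg rm : R) (vnu vtau : R -> R) (rg' rm' : R)
    (lam : 'I_K -> R) :
  0 < dt -> frozen_data P F -> metrics_posdef F ->
  stabilizations_possemidef F ->
  dual_sav_step P dt F rg rm vnu vtau rg' rm' lam ->
  (rm' ^+ 2 - rm ^+ 2) / dt <= - Gtau F vtau vtau - dt * Dtau F vtau vtau <= 0.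
Proof.
move=> dt_gt0 FP GF DF step.
have [_ _ _ Gpos] := GF; have [_ _ _ Dpos] := DF.
have Vv := dss_vtau step; rewrite -opprD.
apply: implicit_step_dissipation => //; last first.
  apply: addr_ge0; last by rewrite mulr_ge0 ?Dpos // ltW.
  exact: (posdef_on_ge0 (fd_Vtau FP) (fd_Gtau FP)).
have S0 : sav_root (Emesh P) (Cm P) (fcurve F) != 0.
  by rewrite gt_eqF // sqrtr_gt0 (fd_Sm FP).
(* The mesh equations carry no multipliers, so only the force terms have to match. *)
by rewrite (dss_rm step) (dss_tangential step) //; field.
Qed.

(** The horizon [N] is kept because the scheme is assumed solved only for the first [N] steps. *)
Lemma step_nonincreasing (R : numDomainType) (N : nat) (u : nat -> R) :
  (forall n, (n < N)%N -> u n.+1 <= u n) ->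
  forall m n, (m <= n)%N -> (n <= N)%N -> u n <= u m.
Proof.
move=> decr m; elim=> [|n IHn]; first by rewrite leqn0 => /eqP->.
rewrite leq_eqVlt => /predU1P[->//|mn] nN.
exact: le_trans (decr _ nN) (IHn mn (ltnW nN)).
Qed.

Lemma dissipation_le (R : realFieldType) (dt x y q : R) :
  0 < dt -> (x - y) / dt <= q <= 0 -> x <= y.
Proof.
move=> dt0 /andP[le_q q0]; have := le_trans le_q q0.
by rewrite pmulr_lle0 ?invr_gt0 // subr_le0.
Qed.

Unset Implicit Arguments.
Set Strict Implicit.

Theorem theorem5p2 (R : realType) (K : nat) (P : functionals R K) (dt : R)
    (hP : admissible_functionals P) (hdt : 0 < dt) :
  (forall (F : frozen R K) (rg rm : R) (vnu vtau : R -> R) (rg' rm' : R)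
      (lam : 'I_K -> R),
    frozen_data P F ->
    metrics_posdef F ->
    stabilizations_possemidef F ->
    rg' != 0 ->
    dual_sav_step P dt F rg rm vnu vtau rg' rm' lam ->
    ((rg' ^+ 2 - rg ^+ 2) / dt <= - Gnu F vnu vnu - dt * Dnu F vnu vnu <= 0)
    /\
    ((rm' ^+ 2 - rm ^+ 2) / dt <= - Gtau F vtau vtau - dt * Dtau F vtau vtau
      <= 0))
  /\
  (forall (N : nat) (F : nat -> frozen R K) (rg rm : nat -> R)
      (vnu vtau : nat -> R -> R) (lam : nat -> 'I_K -> R),
    (forall n, (n < N)%N ->
      [/\ frozen_data P (F n),
          metrics_posdef (F n),
          stabilizations_possemidef (F n),
          rg n.+1 != 0
        & dual_sav_step P dt (F n) (rg n) (rm n) (vnu n.+1) (vtau n.+1)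
            (rg n.+1) (rm n.+1) (lam n.+1)
          /\ fcurve (F n.+1)
             = move_curve (fcurve (F n)) dt (vnu n.+1) (vtau n.+1)]) ->
    forall m n, (m <= n)%N -> (n <= N)%N ->
      rg n ^+ 2 <= rg m ^+ 2 /\ rm n ^+ 2 <= rm m ^+ 2).
Proof.
split=> [F rg rm vnu vtau rg' rm' lam FP GF DF rg'0 step|].
  split; first exact: normal_energy_dissipation hdt FP GF DF step rg'0.
  exact: tangential_energy_dissipation hdt FP GF DF step.
move=> N F rg rm vnu vtau lam steps m n mn nN.
split.
  apply: (step_nonincreasing (u := fun k => rg k ^+ 2)) mn nN => k kN.
  have [FP GF DF rg'0 [step _]] := steps _ kN.
  exact: dissipation_le hdt (normal_energy_dissipation hdt FP GF DF step rg'0).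
apply: (step_nonincreasing (u := fun k => rm k ^+ 2)) mn nN => k kN.
have [FP GF DF _ [step _]] := steps _ kN.
exact: dissipation_le hdt (tangential_energy_dissipation hdt FP GF DF step).
Qed.
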